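(* There exists a complete bifurcate tree of doubly infinite words over an alphabet of size $12$.
   Context: A doubly infinite word over $\mathcal{A}$ is a sequence $(w_k)_{k\in\mathbb{Z}}$ of letters of $\mathcal{A}$. It is square-free if none of its finite contiguous factors is a square, a square being a nonempty word of the form $XX$. A position of a doubly infinite word is a gap between two consecutive letters $w_k,w_{k+1}$; an extension at that position is the doubly infinite word obtained by inserting a single letter $\mathtt{x}\in\mathcal{A}$ between $w_k$ and $w_{k+1}$. A square-free doubly infinite word is bifurcate over $\mathcal{A}$ if at every position it has a square-free extension. A complete bifurcate tree of doubly infinite words is a family of bifurcate doubly infinite words arranged as a rooted tree in which the children of each word are single-letter extensions at pairwise different positions, and every word has a child extended at each of its positions. *)

(* Defs.v *)
From mathcomp Require Import all_boot all_order all_algebra.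
Set Implicit Arguments. Unset Strict Implicit. Unset Printing Implicit Defensive.
Import Order.TTheory GRing.Theory Num.Theory.
Local Open Scope ring_scope.

(* A doubly infinite word over A is a map int -> A (letter w_k at index k). *)

Definition has_square_at {A : eqType} (w : int -> A) (i : int) (n : nat) : Prop :=
  (0 < n)%N /\ forall m : nat, (m < n)%N -> w (i + m%:Z) = w (i + n%:Z + m%:Z).

Definition square_free {A : eqType} (w : int -> A) : Prop :=
  forall (i : int) (n : nat), ~ has_square_at w i n.

(* Position k is the gap between w_k and w_(k+1).  The extension at position k
   by the letter x inserts x there: indices <= k unchanged, x at index k+1,
   and the old letter w_j moves to index j+1 for j > k. *)
Definition extension {A : Type} (w : int -> A) (k : int) (x : A) : int -> A :=
  fun j => if j <= k then w j else if j == k + 1 then x else w (j - 1).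

Definition bifurcate {A : eqType} (w : int -> A) : Prop :=
  square_free w /\ forall k : int, exists x : A, square_free (extension w k x).

(* A complete bifurcate tree: nodes are finite sequences of positions
   (the root is [::]); the node (rcons s k) is the unique child of s, and it
   is a single-letter extension of the word at s at position k.  So every
   word has exactly one child extended at each of its positions, children
   are at pairwise different positions, and every word is bifurcate. *)
Definition complete_bifurcate_tree {A : eqType} (T : seq int -> int -> A) : Prop :=
  (forall s, bifurcate (T s)) /\
  (forall (s : seq int) (k : int), exists x : A, T (rcons s k) = extension (T s) k x).

(* Main.v *)
Require Import Defs.
From Stdlib Require Import FunctionalExtensionality.
From mathcomp Require Import all_boot all_order all_algebra.
From mathcomp Require Import zify.

(** Each letter carries a level and an index. A letter inserted between two
    letters of the same level [k] gets level [k + 1] and index [0]; between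
    letters of different levels it takes the higher level, and the index that
    prolongs the run of the higher neighbour. The letter is then coloured by
    the pair (quaternary level, ternary index), where [ternary] is a two-sided
    square-free word derived from Thue-Morse, and [quaternary] is [ternary]
    with a fourth symbol inserted after every second letter, hence square-free
    and without palindromes. Levels perform a lazy walk on [int], and such a
    walk can spell a square in [quaternary] only if its two halves coincide.
    In a square of colours the letters of minimal level then have consecutive
    indices and spell a square in [ternary], which is impossible. This is the
    nonrepetitive colouring of outerplanar graphs of Kuendgen and Pelsmajer. *)

Set Implicit Arguments. Unset Strict Implicit. Unset Printing Implicit Defensive.
Import Order.TTheory GRing.Theory Num.Theory.
Local Open Scope ring_scope.

(** * The two-sided Thue-Morse sequences *)

Fixpoint bit_parity (fuel n : nat) : bool :=
  if fuel is f.+1 then odd n (+) bit_parity f n./2 else false.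

Lemma bit_parity_fuel (f n : nat) : (n <= f)%N -> bit_parity f n = bit_parity n n.
Proof.
elim/ltn_ind: n f => -[|n] IH [|f] //= le_nf.
  by elim: f {le_nf} => //= f.
by congr (_ (+) _); rewrite [LHS]IH ?[RHS]IH //; lia.
Qed.

Definition thue_morse (n : nat) : bool := bit_parity n n.

Lemma thue_morseE (n : nat) : thue_morse n = odd n (+) thue_morse n./2.
Proof.
case: n => [|n] //; rewrite /thue_morse [LHS]/=; congr (_ (+) _).
by apply: bit_parity_fuel; lia.
Qed.

(* The Thue-Morse substitution 0 -> 01, 1 -> 10 has no two-sided fixed point:
   it exchanges the two sequences [thue_morseZ false] and [thue_morseZ true]. *)
Definition thue_morseZ (c : bool) (z : int) : bool :=
  match z with Posz n => thue_morse n | Negz n => c (+) thue_morse n end.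

Lemma thue_morseZ_sub (c r : bool) (z : int) :
  thue_morseZ c (2 * z + r%:Z) = r (+) thue_morseZ (~~ c) z.
Proof.
case: z => n.
  have -> : 2 * Posz n + r%:Z = Posz (2 * n + r)%N by lia.
  rewrite /= thue_morseE; have -> : ((2 * n + r)./2 = n)%N by lia.
  by congr (_ (+) _); rewrite oddD oddM; case: r.
(* As [Negz n] is [-n - 1], the last binary digit appears complemented, which is what negates
   [c]. *)
have -> : 2 * Negz n + r%:Z = Negz (2 * n + ~~ r)%N by lia.
rewrite /= thue_morseE; have -> : ((2 * n + ~~ r)./2 = n)%N by lia.
have -> : odd (2 * n + ~~ r) = ~~ r by rewrite oddD oddM; case: r.
by case: c r (thue_morse n) => -[] [].
Qed.

Lemma int_parity (z : int) : exists (q : int) (r : bool), z = 2 * q + r%:Z.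
Proof. by exists (z %/ 2)%Z, ((z %% 2)%Z == 1); lia. Qed.

(* An overlap of even period descends through the substitution; one of odd
   period would force its first half to alternate, contradicting oddness. *)
Lemma thue_morseZ_overlap_free (c : bool) (i : int) (n : nat) : (0 < n)%N ->
  ~ (forall m : nat, (m <= n)%N ->
       thue_morseZ c (i + m%:Z) = thue_morseZ c (i + n%:Z + m%:Z)).
Proof.
elim/ltn_ind: n c i => n IH c i n_gt0 ov.
have [odd_n|even_n] := boolP (odd n); last first.
  have [q [r Ei]] := int_parity i.
  apply: (IH (n./2) _ (~~ c) q); [lia | lia | move=> m le_m].
  have := ov (2 * m)%N ltac:(lia).
  have -> : i + (2 * m)%N%:Z = 2 * (q + m%:Z) + r%:Z by lia.
  have -> : i + n%:Z + (2 * m)%N%:Z = 2 * (q + (n./2)%:Z + m%:Z) + r%:Z by lia.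
  by rewrite !thue_morseZ_sub => /addbI.
have flip (q : int) : thue_morseZ c (2 * q + 1) = ~~ thue_morseZ c (2 * q).
  have := thue_morseZ_sub c true q; have := thue_morseZ_sub c false q.
  by rewrite /= addr0 => -> ->.
(* If [i + m] is odd, the flip is read in the other half, where the odd shift [n] makes the position
   even. *)
have alt (m : nat) : (m < n)%N ->
    thue_morseZ c (i + m.+1%:Z) = ~~ thue_morseZ c (i + m%:Z).
  move=> lt_mn; have [q [r Eq]] := int_parity (i + m%:Z).
  case: r Eq => Eq.
    rewrite (ov m.+1 lt_mn) (ov m (ltnW lt_mn)).
    have -> : i + n%:Z + m%:Z = 2 * (q + (n./2)%:Z + 1) by lia.
    by rewrite -flip; congr thue_morseZ; lia.
  have -> : i + m%:Z = 2 * q by lia.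
  by rewrite -flip; congr thue_morseZ; lia.
have alts (m : nat) : (m <= n)%N ->
    thue_morseZ c (i + m%:Z) = odd m (+) thue_morseZ c i.
  elim: m => [|m IHm] le_mn; first by rewrite addr0.
  by rewrite alt // IHm ?(ltnW le_mn) //= addNb.
have := ov 0%N (leq0n n); rewrite !addr0 (alts n (leqnn n)) odd_n.
by case: (thue_morseZ c i).
Qed.

(** * The ternary square-free word *)

Definition ternary (z : int) : nat :=
  let a := thue_morseZ false z in
  if a == thue_morseZ false (z + 1) then 0 else if a then 2 else 1.

Lemma ternary_lt3 (z : int) : (ternary z < 3)%N.
Proof. by rewrite /ternary; case: eqP => //; case: ifP. Qed.

(** Letters 0, 1, 2 mark a constant, rising or falling pair of Thue-Morse bits. If the halves of a
    square start with equal bits, they agree on [n + 1] bits, an overlap. Otherwise opposite bits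
    can share only the letter 0, so the bits never change, although [w i] and [w (i + n)] differ. *)
Lemma ternary_square_free : square_free ternary.
Proof.
move=> i n [n_gt0 sq]; set w := thue_morseZ false.
have step (m : nat) : (m < n)%N ->
    ternary (i + m%:Z) = ternary (i + n%:Z + m%:Z) by exact: sq.
have succ (x : int) (m : nat) : x + m.+1%:Z = x + m%:Z + 1 by lia.
have [E|neq] := eqVneq (w i) (w (i + n%:Z)).
  apply: (@thue_morseZ_overlap_free false i n n_gt0) => m; rewrite -/w.
  elim: m => [|m IHm] le_mn; first by rewrite !addr0.
  move: (step m le_mn) (IHm (ltnW le_mn)).
  rewrite /ternary -/w (succ i) (succ (i + n%:Z)).
  by do 4 case: (w _).
have const (m : nat) : (m <= n)%N ->
    w (i + m%:Z) = w i /\ w (i + n%:Z + m%:Z) = w (i + n%:Z).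
  elim: m => [|m IHm] le_mn; first by rewrite !addr0.
  have [E1 E2] := IHm (ltnW le_mn).
  move: neq (step m le_mn).
  rewrite /ternary -/w (succ i) (succ (i + n%:Z)) E1 E2.
  by do 4 case: (w _).
by case: (const n (leqnn n)) => E _; rewrite E eqxx in neq.
Qed.

Lemma ternary_neq_succ (z : int) : ternary z <> ternary (z + 1).
Proof.
move=> E; apply: (@ternary_square_free z 1); split=> // -[|//] _.
by rewrite !addr0.
Qed.

(** * The four-letter word *)

Definition quaternary (z : int) : nat :=
  let q := (z %/ 3)%Z in let r := (z %% 3)%Z in
  if r == 0 then 3 else if r == 1 then ternary (2 * q) else ternary (2 * q + 1).

Lemma quaternary_lt4 (z : int) : (quaternary z < 4)%N.
Proof. by rewrite /quaternary; do 2 case: ifP => // _; apply/leqW/ternary_lt3. Qed.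

Lemma quaternary0 (q : int) : quaternary (3 * q) = 3%N.
Proof. by rewrite /quaternary; have -> : ((3 * q) %% 3)%Z = 0 by lia. Qed.

Lemma quaternary1 (q : int) : quaternary (3 * q + 1) = ternary (2 * q).
Proof.
rewrite /quaternary; have -> : ((3 * q + 1) %% 3)%Z = 1 by lia.
by have -> : ((3 * q + 1) %/ 3)%Z = q by lia.
Qed.

Lemma quaternary2 (q : int) : quaternary (3 * q + 2) = ternary (2 * q + 1).
Proof.
rewrite /quaternary; have -> : ((3 * q + 2) %% 3)%Z = 2 by lia.
by have -> : ((3 * q + 2) %/ 3)%Z = q by lia.
Qed.

Lemma quaternary_eq3 (z : int) : quaternary z = 3%N -> exists q, z = 3 * q.
Proof.
move=> E; exists (z %/ 3)%Z; move: E; rewrite /quaternary.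
case: eqP => [|_]; first by lia.
by case: ifP => _ E; have := ternary_lt3 (2 * (z %/ 3)%Z);
  have := ternary_lt3 (2 * (z %/ 3)%Z + 1); lia.
Qed.

Lemma int_mod3 (z : int) : exists q : int, z = 3 * q \/ z = 3 * q + 1 \/ z = 3 * q + 2.
Proof. by exists (z %/ 3)%Z; lia. Qed.

Lemma quaternary_neq_near (x d : int) : d = 1 \/ d = 2 ->
  quaternary x <> quaternary (x + d).
Proof.
have [q] := int_mod3 x.
have T := ternary_lt3.
case=> [->|[]->] [] ->; rewrite ?quaternary0 ?quaternary1 ?quaternary2.
- by have := T (2 * q); lia.
- by have := T (2 * q + 1); lia.
- have -> : 3 * q + 1 + 1 = 3 * q + 2 by lia.
  by rewrite quaternary2; exact: ternary_neq_succ.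
- have -> : 3 * q + 1 + 2 = 3 * (q + 1) by lia.
  by rewrite quaternary0; have := T (2 * q); lia.
- have -> : 3 * q + 2 + 1 = 3 * (q + 1) by lia.
  by rewrite quaternary0; have := T (2 * q + 1); lia.
- have -> : 3 * q + 2 + 2 = 3 * (q + 1) + 1 by lia.
  rewrite quaternary1; have -> : 2 * (q + 1) = 2 * q + 1 + 1 by lia.
  exact: ternary_neq_succ.
Qed.

(** Makes a step of at most 1 from a known level readable from the colour reached. *)
Lemma quaternary_inj_near (x y : int) : - 2 <= x - y <= 2 ->
  quaternary x = quaternary y -> x = y.
Proof.
move=> le_xy E; have [lt_xy|lt_yx|//] := ltgtP x y.
  have /(_ ltac:(lia)) := @quaternary_neq_near x (y - x).
  by rewrite addrC subrK E.
have /(_ ltac:(lia)) := @quaternary_neq_near y (x - y).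
by rewrite addrC subrK E.
Qed.

(** The symbol 3 sits exactly at the multiples of 3, so the period is [3 * k]; erasing the 3s leaves
    a square of period [2 * k] in [ternary]. *)
Lemma quaternary_square_free : square_free quaternary.
Proof.
move=> i n [n_gt0 sq].
have n_ge3 : (3 <= n)%N.
  rewrite leqNgt; apply/negP => n_lt3; move: (sq 0%N n_gt0); rewrite !addr0.
  by apply: quaternary_neq_near; lia.
have [k Ek] : exists k : nat, n = (3 * k)%N.
  have [m [lt_m [q Em]]] : exists m : nat, (m < n)%N /\ exists q, i + m%:Z = 3 * q.
    have [q [E|[E|E]]] := int_mod3 i.
    - by exists 0%N; split; [lia | exists q; lia].
    - by exists 2; split; [lia | exists (q + 1); lia].
    - by exists 1; split; [lia | exists (q + 1); lia].
  have := sq m lt_m; rewrite Em quaternary0 => /esym/quaternary_eq3[q' Eq'].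
  by exists (n %/ 3)%N; lia.
(* [h l] is the offset in the square of its [l]-th letter other than 3, and [s] the [ternary] index
   of the first one. *)
have tern (s : int) (h : nat -> nat) :
  (forall l : nat, (l < 2 * k)%N -> (h l < n)%N /\
     exists q, (i + (h l)%:Z = 3 * q + 1 /\ s + l%:Z = 2 * q) \/
               (i + (h l)%:Z = 3 * q + 2 /\ s + l%:Z = 2 * q + 1)) -> False.
  move=> H; apply: (@ternary_square_free s (2 * k)); split; first by lia.
  move=> l lt_l; have [lt_h [q Eq]] := H l lt_l; have := sq _ lt_h.
  case: Eq => -[E1 E2].
    have -> : i + n%:Z + (h l)%:Z = 3 * (q + k%:Z) + 1 by lia.
    rewrite E1 !quaternary1 E2 => ->; congr ternary; lia.
  have -> : i + n%:Z + (h l)%:Z = 3 * (q + k%:Z) + 2 by lia.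
  rewrite E1 !quaternary2 E2 => ->; congr ternary; lia.
have [q [E|[E|E]]] := int_mod3 i.
- apply: (tern (2 * q) (fun l => 3 * (l %/ 2) + l %% 2 + 1)%N) => l lt_l.
  by split; [lia | exists (q + (l %/ 2)%N%:Z); lia].
- apply: (tern (2 * q) (fun l => 3 * (l %/ 2) + l %% 2)%N) => l lt_l.
  by split; [lia | exists (q + (l %/ 2)%N%:Z); lia].
- apply: (tern (2 * q + 1) (fun l => 3 * (l.+1 %/ 2) + l.+1 %% 2 - 1)%N) => l lt_l.
  by split; [lia | exists (q + (l.+1 %/ 2)%N%:Z); lia].
Qed.

(** * Lazy walks on the four-letter word *)

(* As long as the second half of the walk mimics the colours of the first, it
   is the image of the first under one translation or reflection, which
   preserves the colours on the whole interval visited so far. *)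
Lemma mimicking_walk (u v : nat -> int) (n : nat) :
  (forall j : nat, - 1 <= u j.+1 - u j <= 1) ->
  (forall j : nat, - 1 <= v j.+1 - v j <= 1) ->
  (forall j : nat, (j <= n)%N -> quaternary (u j) = quaternary (v j)) ->
  forall j : nat, (j <= n)%N -> exists lo hi c e : int,
    [/\ e = 1 \/ e = -1, lo <= u 0%N <= hi, lo <= u j <= hi,
        v 0%N = c + e * u 0%N /\ v j = c + e * u j &
        forall x, lo <= x <= hi -> quaternary (c + e * x) = quaternary x].
Proof.
move=> stepu stepv col; elim=> [|j IHj] le_jn.
  exists (u 0%N), (u 0%N), (v 0%N - u 0%N), 1; split; [by left|lia|lia|lia|].
  move=> x Hx; have -> : x = u 0%N by lia.
  by rewrite mul1r subrK -col.
have [lo [hi [c [e [He H0 Hj [E0 Ej] inv]]]]] := IHj (ltnW le_jn).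
have := stepu j; have := stepv j; have := col _ le_jn.
set x := u j in Hj Ej *; set x' := u j.+1; set y' := v j.+1.
rewrite Ej => Cx Sv Su.
have [in_range|out] := boolP (lo <= x' <= hi).
  exists lo, hi, c, e; split=> //; split=> //.
  apply: quaternary_inj_near; first by case: He => ?; subst e; lia.
  by rewrite -Cx inv.
have near := quaternary_inj_near.
have Nx : x' <> x by lia.
have Ny : y' <> c + e * x.
  by move=> E; apply: Nx; apply: near; [lia | rewrite Cx E inv].
(* [x] is an endpoint. If [lo < hi], its inner neighbour is [2 * x - x'], whose image is excluded
   for [y'], so the same map extends to [x']. *)
have [lohi|lohi] : lo < hi \/ lo = hi by lia.
  have Nback : y' <> c + e * (2 * x - x').
    move=> E; have /near : quaternary x' = quaternary (2 * x - x').
      by rewrite Cx E inv //; lia.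
    by lia.
  have Ey : y' = c + e * x' by case: He => ?; subst e; lia.
  exists (Num.min lo x'), (Num.max hi x'), c, e; split=> //; try lia.
  move=> z Hz; have [->|Nz] := eqVneq z x'; first by rewrite -Ey Cx.
  by apply: inv; lia.
(* On a one-point interval the sign is still free: the move to [y'] fixes it, and the new offset
   keeps the image of [x]. *)
have Eu : u 0%N = x by lia.
have [e' He' Ey] : exists2 e', e' = 1 \/ e' = -1 &
    y' = (c + e * x - e' * x) + e' * x'.
  move: Ny Sv; move: (c + e * x) => y Ny Sv.
  have [?|?] : y' - y = x' - x \/ y' - y = x - x' by lia.
    by exists 1; [left | lia].
  by exists (-1); [right | lia].
exists (Num.min x x'), (Num.max x x'), (c + e * x - e' * x), e'; split=> //; try lia.
move=> z Hz; have [->|Nz] := eqVneq z x'; first by rewrite -Ey Cx.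
have -> : z = x by lia.
by rewrite subrK inv.
Qed.

(** Halves starting at the same level stay together. Otherwise a translation or reflection maps the
    first to the second; as the second starts within 1 of the end of the first, the visited interval
    is long enough for a contradiction. *)
Lemma lazy_walk_boring (u : nat -> int) (n : nat) :
  (forall j : nat, - 1 <= u j.+1 - u j <= 1) ->
  (forall j : nat, (j < n)%N -> quaternary (u j) = quaternary (u (n + j)%N)) ->
  forall j : nat, (j < n)%N -> u j = u (n + j)%N.
Proof.
move=> step; case: n => [//|n] col.
have [E0|N0] := eqVneq (u 0%N) (u n.+1).
  elim=> [|j IHj] lt_j; first by rewrite addn0.
  apply: quaternary_inj_near; last exact: col.
  have := IHj (ltnW lt_j); have := step j; have := step (n.+1 + j)%N.
  by rewrite addnS; lia.
have [||j lt_j|lo [hi [c [e [He H0 Hn [E0 _] inv]]]]] :=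
  @mimicking_walk u (fun j => u (n.+1 + j)%N) n _ _ _ n (leqnn n).
- exact: step.
- by move=> j; have := step (n.+1 + j)%N; rewrite addnS.
- exact: col.
rewrite addn0 in E0; have := step n; move: N0; rewrite E0; set a := u 0%N in H0 *.
set z := u n in Hn *.
case: He => ?; subst e; rewrite ?mul1r => N0 Sn; exfalso; last first.
  (* The reflection is centred at [a + d / 2]; the nearest other point on the side of [a] and its
     mirror image are at distance 1 or 2. *)
  set d := c - 2 * a.
  have [d_gt0|d_lt0] : 0 < d \/ d < 0 by rewrite /d; lia.
    have /quaternary_inj_near := inv (a + ((d - 1) %/ 2)%Z) ltac:(rewrite /d in d_gt0 *; lia).
    by rewrite /d in d_gt0 *; lia.
  have /quaternary_inj_near := inv (a - ((- d - 1) %/ 2)%Z) ltac:(rewrite /d in d_lt0 *; lia).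
  by rewrite /d in d_lt0 *; lia.
(* The interval has at least [|c|] points; with their translates they form a square of period
   [|c|]. *)
have [c_gt0|c_lt0] : 0 < c \/ c < 0 by lia.
  apply: (@quaternary_square_free lo `|c|%N); split; first by lia.
  move=> m lt_m; rewrite -(inv (lo + m%:Z)); last by lia.
  by congr quaternary; lia.
apply: (@quaternary_square_free (lo + c) `|c|%N); split; first by lia.
move=> m lt_m.
have -> : lo + c + (`|c|%N)%:Z + m%:Z = lo + m%:Z by lia.
rewrite -(inv (lo + m%:Z)); last by lia.
by congr quaternary; lia.
Qed.

(** * Counting occurrences *)

Definition count_below (P : nat -> bool) (m : nat) : nat := (\sum_(l < m) P l)%N.

Lemma count_belowS (P : nat -> bool) (m : nat) :
  count_below P m.+1 = (count_below P m + P m)%N.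
Proof. by rewrite /count_below big_ord_recr. Qed.

Lemma count_below_last (P : nat -> bool) (m : nat) :
  (count_below P m = 0%N /\ forall l : nat, (l < m)%N -> ~~ P l) \/
  exists a : nat, [/\ (a < m)%N, P a, count_below P m = (count_below P a).+1 &
    forall l : nat, (a < l < m)%N -> ~~ P l].
Proof.
elim: m => [|m IHm]; first by left; rewrite /count_below big_ord0.
rewrite count_belowS; have [Pm|NPm] := boolP (P m).
  by right; exists m; split=> //; [rewrite addn1 | move=> l; lia].
rewrite addn0; case: IHm => [[-> H]|[a [lt_am Pa -> H]]].
  left; split=> // l; rewrite ltnS leq_eqVlt => /predU1P[->//|]; exact: H.
right; exists a; split=> //; first exact: ltnW.
move=> l /andP[lt_al]; rewrite ltnS leq_eqVlt => /predU1P[->//|lt_lm].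
by apply: H; rewrite lt_al.
Qed.

Lemma count_below_onto (P : nat -> bool) (n t : nat) : (t < count_below P n)%N ->
  exists m : nat, [/\ (m < n)%N, P m & count_below P m = t].
Proof.
elim: n => [|n IHn]; first by rewrite /count_below big_ord0.
rewrite count_belowS; have [lt_t _|ge_t] := ltnP t (count_below P n).
  by have [m [lt_m Pm E]] := IHn lt_t; exists m; split=> //; exact: ltnW.
by case Pn: (P n) => H; [exists n; split=> //; lia | lia].
Qed.

Lemma count_below_period (P : nat -> bool) (n m : nat) : (m <= n)%N ->
  (forall l : nat, (l < n)%N -> P (n + l)%N = P l) ->
  count_below P (n + m) = (count_below P n + count_below P m)%N.
Proof.
move=> + per; elim: m => [|m IHm] le_mn.
  by rewrite addn0 {3}/count_below big_ord0 addn0.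
by rewrite addnS !count_belowS per // IHm ?(ltnW le_mn) // addnA.
Qed.

(** * Labels and insertion *)

(* Labels are pairs (level, index). Among the letters of level at most [k],
   consecutive ones of level exactly [k] have consecutive indices. *)
Definition well_labelled (L : int -> int * int) : Prop :=
  (forall j : int, - 1 <= (L (j + 1)).1 - (L j).1 <= 1) /\
  (forall i j : int, i < j -> (L i).1 = (L j).1 ->
     (forall x : int, i < x < j -> (L i).1 < (L x).1) -> (L j).2 = (L i).2 + 1).

Definition new_label (u v : int * int) : int * int :=
  if u.1 == v.1 then (u.1 + 1, 0)
  else if u.1 < v.1 then (v.1, v.2 - 1) else (u.1, u.2 + 1).

Definition insert_label (L : int -> int * int) (k : int) : int -> int * int :=
  extension L k (new_label (L k) (L (k + 1))).

Section Extension.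
Variables (A : Type) (w : int -> A) (k : int) (x : A).

Lemma extension_before (j : int) : j <= k -> extension w k x j = w j.
Proof. by rewrite /extension => ->. Qed.

Lemma extension_at : extension w k x (k + 1) = x.
Proof. by rewrite /extension eqxx; case: ifP => //; lia. Qed.

Lemma extension_after (j : int) : k < j -> extension w k x (j + 1) = w j.
Proof.
rewrite /extension => lt_kj; case: ifP => [|_]; first by lia.
by case: eqP => [|_]; [lia | rewrite addrK].
Qed.
End Extension.

(** The new letter is at least as high as both neighbours, so within a run it can only be adjacent
    to a neighbour of its own level. For two old letters the condition on the letters between them
    only gets stronger. *)
Lemma well_labelled_insert (L : int -> int * int) (k : int) :
  well_labelled L -> well_labelled (insert_label L k).
Proof.
move=> [step idx]; rewrite /insert_label; set x := new_label _ _.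
set E := extension L k x.
have Eb (j : int) : j <= k -> E j = L j by exact: extension_before.
have Em : E (k + 1) = x by exact: extension_at.
have Ea (j : int) : k < j -> E (j + 1) = L j by exact: extension_after.
have Ek1 : E (k + 1 + 1) = L (k + 1) by apply: Ea; lia.
have Sk := step k.
have [le_ux [le_vx [ux [vx [Hu Hv]]]]] :
  (L k).1 <= x.1 /\ (L (k + 1)).1 <= x.1 /\ x.1 <= (L k).1 + 1 /\
  x.1 <= (L (k + 1)).1 + 1 /\
  ((L k).1 = x.1 -> x.2 = (L k).2 + 1) /\
  ((L (k + 1)).1 = x.1 -> (L (k + 1)).2 = x.2 + 1).
  by rewrite /x /new_label; case: eqP => /= ?; [lia | case: ifP => /= ?; lia].
have place (j : int) : j <= k \/ j = k + 1 \/ exists2 j', j = j' + 1 & k < j'.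
  have : j <= k \/ j = k + 1 \/ k + 1 < j by lia.
  by case=> [|[]]; [left|right;left|right;right; exists (j - 1); lia].
split=> [j|i j].
  case: (place j) => [le_jk|[->|[j' -> lt_kj']]].
  - rewrite (Eb j) //; have [lt_jk|->] : j < k \/ j = k by lia.
      by rewrite Eb; [exact: step | lia].
    by rewrite Em; lia.
  - by rewrite Ek1 Em; lia.
  - by rewrite !Ea //; lia.
case: (place i) => [le_ik|[->|[i' -> lt_ki']]];
  case: (place j) => [le_jk|[->|[j' -> lt_kj']]] lt_ij.
- rewrite !Eb // => El H; apply: idx => // y Hy.
  by have := H y Hy; rewrite Eb //; lia.
- rewrite Em (Eb i) // => El H; have [lt_ik|Ei] : i < k \/ i = k by lia.
    by have := H k ltac:(lia); rewrite Eb //; lia.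
  by subst i; apply: Hu.
- rewrite (Eb i) // Ea // => El H; apply: idx => // [|y Hy]; first by lia.
  have [le_yk|lt_ky] := lerP y k.
    by have := H y ltac:(lia); rewrite Eb.
  by have := H (y + 1) ltac:(lia); rewrite Ea.
- by lia.
- by lia.
- rewrite Em Ea // => El H; have [lt_j|Ej] : k + 1 < j' \/ j' = k + 1 by lia.
    by have := H (k + 1 + 1) ltac:(lia); rewrite Ek1; lia.
  by subst j'; apply: Hv.
- by lia.
- by lia.
- rewrite !Ea // => El H; apply: idx => // [|y Hy]; first by lia.
  by have := H (y + 1) ltac:(lia); rewrite Ea //; lia.
Qed.

(** * The twelve colours *)

Definition colour (a : int * int) : 'I_12 :=
  inord (3 * quaternary a.1 + ternary a.2).

Lemma colour_eq (a b : int * int) : colour a = colour b ->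
  quaternary a.1 = quaternary b.1 /\ ternary a.2 = ternary b.2.
Proof.
move/(congr1 (@nat_of_ord 12)); have := quaternary_lt4 a.1.
have := quaternary_lt4 b.1; have := ternary_lt3 a.2; have := ternary_lt3 b.2.
(* Codes are at most [3 * 3 + 2 = 11], so [inord] never falls back to its default. *)
move=> ? ? ? ?; rewrite !inordK; lia.
Qed.

Lemma well_labelled_square_free (L : int -> int * int) :
  well_labelled L -> square_free (fun j => colour (L j)).
Proof.
move=> [step idx] i n [n_gt0 sq].
pose lev (j : nat) : int := (L (i + j%:Z)).1.
pose ind (j : nat) : int := (L (i + j%:Z)).2.
have sq2 (j : nat) : (j < n)%N -> quaternary (lev j) = quaternary (lev (n + j)%N) /\
    ternary (ind j) = ternary (ind (n + j)%N).
  move=> /sq /colour_eq; rewrite /lev /ind.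
  by have -> : i + n%:Z + j%:Z = i + (n + j)%N%:Z by lia.
have per : forall j : nat, (j < n)%N -> lev j = lev (n + j)%N.
  apply: lazy_walk_boring => [j|j /sq2[]//].
  rewrite /lev; have -> : i + j.+1%:Z = i + j%:Z + 1 by lia.
  exact: step.
pose j0 := [arg min_(j < Ordinal n_gt0) lev j]%O.
have minlev (j : nat) : (j < 2 * n)%N -> lev j0 <= lev j.
  have H (l : nat) : (l < n)%N -> lev j0 <= lev l.
    move=> lt_l; rewrite /j0; case: arg_minP => // y _ Hy.
    exact: (Hy (Ordinal lt_l)).
  have [lt_jn _|le_nj lt_j] := ltnP j n; first exact: H.
  by have := per (j - n)%N ltac:(lia); rewrite subnKC // => <-; apply: H; lia.
pose P (j : nat) := lev j == lev j0.
have Pper (l : nat) : (l < n)%N -> P (n + l)%N = P l.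
  by move=> /per E; rewrite /P -E.
(* [q] is the index of the first letter of minimal level; between successive ones all levels are
   higher, so [idx] raises the index by 1. *)
have [q Hq] : exists q, forall m : nat, (m < 2 * n)%N -> P m ->
    ind m = q + (count_below P m)%:Z.
  exists (ind (ex_minn (ex_intro P (j0 : nat) (eqxx _)))).
  case: ex_minnP => m0 Pm0 Hm0; elim/ltn_ind=> m IHm lt_m Pm.
  case: (count_below_last P m) => [[-> H]|[a [lt_am Pa -> H]]].
    rewrite addr0; congr ind; apply/eqP; rewrite eqn_leq Hm0 // andbT leqNgt.
    by apply/negP => /H; rewrite Pm0.
  have Ia := IHm a lt_am ltac:(lia) Pa.
  have -> : ind m = ind a + 1; last by lia.
  apply: idx; [by lia | by rewrite -/(lev a) -/(lev m) (eqP Pa) (eqP Pm) |].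
  move=> x Hx; have Ex : x = i + (`|x - i|%N)%:Z by lia.
  rewrite Ex -/(lev _) -/(lev a) (eqP Pa) lt_neqAle minlev ?andbT; last by lia.
  by rewrite eq_sym; apply: H; lia.
(* The minimal letters of the second half continue the indices of those of the first, so their count
   in one half is the period. *)
apply: (@ternary_square_free q (count_below P n)); split=> [|t lt_t].
  case: (count_below_last P n) => [[_ H]|[a [_ _ -> _]]//].
  by have := H j0 (ltn_ord j0); rewrite /P eqxx.
have [m [lt_m Pm <-]] := count_below_onto lt_t.
rewrite -Hq //; last by lia.
have [_ ->] := sq2 m lt_m; congr ternary.
by rewrite Hq ?Pper // ?(count_below_period (ltnW lt_m) Pper); lia.
Qed.

(** * The tree *)

Definition labels (s : seq int) : int -> int * int :=
  foldl insert_label (fun j => (0, j)) s.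

Lemma well_labelled_labels (s : seq int) : well_labelled (labels s).
Proof.
elim/last_ind: s => [|s k IHs].
  split=> [//|i j lt_ij _ H] /=; have [|lt|//] := ltgtP j (i + 1); first by lia.
  by have := H (i + 1) ltac:(lia); rewrite ltxx.
by rewrite /labels foldl_rcons; exact: well_labelled_insert.
Qed.

Lemma map_extension (A B : Type) (f : A -> B) (w : int -> A) (k : int) (x : A) :
  (fun j => f (extension w k x j)) = extension (fun j => f (w j)) k (f x).
Proof.
by apply: functional_extensionality => j; rewrite /extension !(fun_if f).
Qed.

Theorem mainTheorem6 :
  exists T : seq int -> int -> 'I_12, complete_bifurcate_tree T.
Proof.
pose T s j := colour (labels s j).
have TS (s : seq int) (k : int) : exists x, T (rcons s k) = extension (T s) k x.
  exists (colour (new_label (labels s k) (labels s (k + 1)))).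
  by rewrite /T /labels foldl_rcons; exact: map_extension.
have Tsf (s : seq int) : square_free (T s).
  exact/well_labelled_square_free/well_labelled_labels.
exists T; split=> // s; split=> // k.
by have [x Ex] := TS s k; exists x; rewrite -Ex.
Qed.
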